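(* Let $R\in\mathcal{H}_0$ be a completely integrally closed ring such that $R\neq T(R)$. Then there is no ring $T$ properly containing $R$ (as a subring) such that $\mathrm{Spec}(R)=\mathrm{Spec}(T)$.
   Context: All rings are commutative with nonzero identity, and subrings share the identity of the larger ring. $T(R)$ is the total quotient ring of $R$; $\mathrm{Nil}(R)$ is the set of nilpotent elements of $R$; $Z(R)$ is the set of zero-divisors of $R$. A prime ideal of $R$ is divided if it is comparable (under inclusion) to every ideal of $R$. $\mathcal{H}$ is the class of all rings $R$ such that $\mathrm{Nil}(R)$ is a divided prime ideal of $R$, and $\mathcal{H}_0$ is the class of all $R\in\mathcal{H}$ with $\mathrm{Nil}(R)=Z(R)$. $C(R)$ denotes the complete integral closure of $R$ in $T(R)$, i.e. the set of $x\in T(R)$ for which there is a non-zerodivisor $r\in R$ with $rx^n\in R$ for all $n\geq 1$; $R$ is completely integrally closed if $R=C(R)$. For a subring $R$ of $T$, $\mathrm{Spec}(R)=\mathrm{Spec}(T)$ means that $R$ and $T$ have literally the same prime ideals: every prime ideal of $R$ is (as a subset of $T$) a prime ideal of $T$, and every prime ideal of $T$ is contained in $R$ and is a prime ideal of $R$. The ring $T$ is not assumed to be contained in $T(R)$. *)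

(* Defs.v *)
From HB Require Import structures.
From mathcomp Require Import all_boot all_algebra.
From mathcomp Require Import boolp classical_sets.

Set Implicit Arguments.
Unset Strict Implicit.
Unset Printing Implicit Defensive.

Import GRing.Theory.
Local Open Scope ring_scope.
Local Open Scope quotient_scope.
Local Open Scope classical_set_scope.

Section Elements.
Variable R : comNzRingType.

Definition nilradical : set R := [set x | exists n : nat, x ^+ n = 0].

Definition zero_divisors : set R := [set x | exists2 y : R, y != 0 & x * y = 0].

(* The non-zerodivisors of a commutative ring are its regular elements. *)
Lemma lregNzero_divisors (x : R) : GRing.lreg x <-> ~ zero_divisors x.
Proof.
split=> [xreg [y /negP y0 /eqP]|xNzd]; first by rewrite mulrI_eq0.
by apply: mulrI0_lreg => y xy0; apply: contra_notP xNzd => /eqP; exists y.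
Qed.

End Elements.

Arguments nilradical R : clear implicits.
Arguments zero_divisors R : clear implicits.

(* The total quotient ring, built as {fraction R} is in mathcomp.fraction, but
   with regular denominators and without assuming that R is a domain. *)
Module TotalQuotient.
Section TotalQuotient.
Variable R : comNzRingType.

Record ratio := Ratio { frac : R * R; _ : `[< GRing.lreg frac.2 >] }.

HB.instance Definition _ := [isSub for frac].
HB.instance Definition _ := [Choice of ratio by <:].

Implicit Types x y z : ratio.

Local Notation "'\n_' x" := (frac x).1
  (at level 8, x at level 2, format "'\n_' x").
Local Notation "'\d_' x" := (frac x).2
  (at level 8, x at level 2, format "'\d_' x").

Lemma denomP x : GRing.lreg \d_x.
Proof. by case: x => -[n d] /= /asboolP. Qed.

Definition mkratio (n d : R) (dreg : GRing.lreg d) : ratio :=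
  @Ratio (n, d) (introT (asboolP _) dreg).

(* As denominators are regular, no auxiliary multiplier is needed here. *)
Definition equivf x y := \n_x * \d_y == \d_x * \n_y.

Lemma equivf_refl : reflexive equivf.
Proof. by move=> x; rewrite /equivf mulrC. Qed.

Lemma equivf_sym : symmetric equivf.
Proof. by move=> x y; rewrite /equivf eq_sym; congr (_ == _); rewrite mulrC. Qed.

Lemma equivf_trans : transitive equivf.
Proof.
move=> y x z; rewrite /equivf => /eqP xy /eqP yz; apply/eqP/(@denomP y).
by rewrite mulrCA mulrA xy -mulrA yz mulrCA.
Qed.

Canonical equivf_equiv := EquivRel equivf equivf_refl equivf_sym equivf_trans.

Definition type := {eq_quot equivf}.

HB.instance Definition _ : EqQuotient _ equivf type := EqQuotient.on type.
HB.instance Definition _ := Choice.on type.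

Lemma equivf_r x : \n_x * \d_(repr (\pi_type x)) = \d_x * \n_(repr (\pi_type x)).
Proof. by apply/eqP; rewrite -[_ == _]/(equivf _ _) -eqmodE reprK. Qed.

Lemma equivf_l x : \n_(repr (\pi_type x)) * \d_x = \d_(repr (\pi_type x)) * \n_x.
Proof. by rewrite mulrC -equivf_r mulrC. Qed.

Definition embed (a : R) : ratio := @mkratio a 1 (@GRing.lreg1 R).
Definition tofrac := lift_embed type embed.
Canonical tofrac_pi_morph := PiEmbed tofrac.

Definition addf x y : ratio :=
  mkratio (\n_x * \d_y + \n_y * \d_x) (GRing.lregM (@denomP x) (@denomP y)).
Definition add := lift_op2 type addf.

Lemma pi_add : {morph \pi : x y / addf x y >-> add x y}.
Proof.
move=> x y; unlock add; apply/eqmodP; rewrite /= /equivf /addf /=.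
rewrite mulrDr mulrDl; apply/eqP; symmetry.
rewrite (AC (2*2) (3*1*2*4)) (AC (2*2) (3*2*1*4))/=.
by rewrite !equivf_l (ACl ((2*3)*(1*4))) (ACl ((2*3)*(4*1)))/=.
Qed.
Canonical pi_add_morph := PiMorph2 pi_add.

Definition oppf x : ratio := mkratio (- \n_x) (@denomP x).
Definition opp := lift_op1 type oppf.

Lemma pi_opp : {morph \pi : x / oppf x >-> opp x}.
Proof.
move=> x; unlock opp; apply/eqmodP; rewrite /= /equivf /oppf /=.
by rewrite mulNr mulrN -equivf_r.
Qed.
Canonical pi_opp_morph := PiMorph1 pi_opp.

Definition mulf x y : ratio :=
  mkratio (\n_x * \n_y) (GRing.lregM (@denomP x) (@denomP y)).
Definition mul := lift_op2 type mulf.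

Lemma pi_mul : {morph \pi : x y / mulf x y >-> mul x y}.
Proof.
move=> x y; unlock mul; apply/eqmodP=> /=.
by rewrite /equivf /= mulrACA !equivf_r mulrACA.
Qed.
Canonical pi_mul_morph := PiMorph2 pi_mul.

Lemma ratio_eq x y : frac x = frac y -> x = y. Proof. exact: val_inj. Qed.

Lemma addA : associative add.
Proof.
elim/quotW=> x; elim/quotW=> y; elim/quotW=> z; rewrite !piE.
congr (\pi _); apply: ratio_eq => /=.
by rewrite !mulrDl !mulrA !addrA ![_ * _ * \d_x]mulrAC.
Qed.

Lemma addC : commutative add.
Proof.
elim/quotW=> x; elim/quotW=> y; rewrite !piE; congr (\pi _).
by apply: ratio_eq; rewrite /= addrC [\d__ * _]mulrC.
Qed.

Lemma add0_l : left_id (tofrac 0) add.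
Proof.
elim/quotW=> x; rewrite !piE; congr (\pi _); apply: ratio_eq => /=.
by rewrite mul0r mul1r mulr1 add0r -surjective_pairing.
Qed.

Lemma addN_l : left_inverse (tofrac 0) opp add.
Proof.
elim/quotW=> x; apply/eqP; rewrite piE /equivf /=.
by rewrite mulr1 mulr0 mulNr addNr.
Qed.

HB.instance Definition _ := GRing.isZmodule.Build type addA addC add0_l addN_l.

Lemma mulA : associative mul.
Proof.
elim/quotW=> x; elim/quotW=> y; elim/quotW=> z; rewrite !piE.
by congr (\pi _); apply: ratio_eq; rewrite /= !mulrA.
Qed.

Lemma mulC : commutative mul.
Proof.
elim/quotW=> x; elim/quotW=> y; rewrite !piE; congr (\pi _).
by apply: ratio_eq; rewrite /= [_ * \d_x]mulrC [_ * \n_x]mulrC.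
Qed.

Lemma mul1_l : left_id (tofrac 1) mul.
Proof.
elim/quotW=> x; rewrite !piE; congr (\pi _); apply: ratio_eq => /=.
by rewrite !mul1r -surjective_pairing.
Qed.

Lemma mul_addl : left_distributive mul add.
Proof.
elim/quotW=> x; elim/quotW=> y; elim/quotW=> z; apply/eqP.
rewrite !piE /equivf /mulf /addf /=; apply/eqP.
rewrite !(mulrDr, mulrDl) (AC (3*(2*2)) (4*2*7*((1*3)*(6*5))))/=.
by rewrite [X in _ + X](AC (3*(2*2)) (4*6*7*((1*3)*(2*5))))/=.
Qed.

Lemma nonzero1 : tofrac 1 != tofrac 0 :> type.
Proof. by rewrite piE /equivf /= !mul1r oner_eq0. Qed.

HB.instance Definition _ :=
  GRing.Zmodule_isComNzRing.Build type mulA mulC mul1_l mul_addl nonzero1.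

Lemma tofrac_is_zmod_morphism : zmod_morphism tofrac.
Proof.
move=> a b /=; unlock tofrac; rewrite -[X in _ = _ + X]pi_opp -[RHS]pi_add.
by congr (\pi _); apply: ratio_eq; rewrite /= !mulr1.
Qed.

HB.instance Definition _ :=
  GRing.isZmodMorphism.Build R type tofrac tofrac_is_zmod_morphism.

Lemma tofrac_is_monoid_morphism : monoid_morphism tofrac.
Proof.
split=> [//|a b]; unlock tofrac; rewrite -[RHS]pi_mul.
by congr (\pi _); apply: ratio_eq; rewrite /= mulr1.
Qed.

HB.instance Definition _ :=
  GRing.isMonoidMorphism.Build R type tofrac tofrac_is_monoid_morphism.

Lemma tofrac_inj : injective tofrac.
Proof.
move=> a b; unlock tofrac => /eqmodP /eqP /=.
by rewrite mulr1 mul1r.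
Qed.

Lemma tofrac_unit (r : R) :
  GRing.lreg r -> exists u : type, tofrac r * u = 1.
Proof.
move=> rreg; exists (\pi_type (mkratio 1 rreg)).
rewrite -[LHS]/(mul _ _) -[RHS]/(tofrac 1) !piE; apply/eqP.
by rewrite piE /equivf /= !mulr1 !mul1r.
Qed.

Lemma tofrac_surj (x : type) :
  exists a r : R, GRing.lreg r /\ tofrac r * x = tofrac a.
Proof.
elim/quotW: x => x; exists \n_x, \d_x; split; first exact: denomP.
rewrite -[LHS]/(mul _ _) !piE; apply/eqP.
by rewrite piE /equivf /= mulr1 mul1r.
Qed.

End TotalQuotient.
End TotalQuotient.
HB.export TotalQuotient.

Notation total_quotient := TotalQuotient.type.
Notation to_total_quotient := (@TotalQuotient.tofrac _).

Section Ideals.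
Variable R : comNzRingType.

(* idealr_closed excludes the unit ideal, hence this definition. *)
Definition ideal (I : set R) : Prop :=
  I 0 /\ forall a u v : R, I u -> I v -> I (a * u + v).

Definition prime_ideal (P : set R) : Prop :=
  idealr_closed [in P] /\ prime_idealr_closed [in P].

Definition divided_prime (P : set R) : Prop :=
  prime_ideal P /\ forall I : set R, ideal I -> P `<=` I \/ I `<=` P.

End Ideals.

Definition class_H (R : comNzRingType) : Prop := divided_prime (nilradical R).

Definition class_H0 (R : comNzRingType) : Prop :=
  class_H R /\ nilradical R = zero_divisors R.

Definition complete_integral_closure (R : comNzRingType) :
    set (total_quotient R) :=
  [set x | exists2 r : R, GRing.lreg r &
     forall n, (0 < n)%N ->
       range to_total_quotient (to_total_quotient r * x ^+ n)].

Definition completely_integrally_closed (R : comNzRingType) : Prop :=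
  range (@TotalQuotient.tofrac R) = @complete_integral_closure R.

(* Spec(R) = Spec(T), the ring R being identified with its image under f, which
   is meant to be injective. *)
Definition same_spec (R T : comNzRingType) (f : {rmorphism R -> T}) : Prop :=
  (forall P : set R, prime_ideal P -> prime_ideal (f @` P)) /\
  (forall Q : set T, prime_ideal Q ->
     Q `<=` range f /\ prime_ideal (f @^-1` Q)).

(* Main.v *)
Require Import Defs.
From mathcomp Require Import all_boot all_algebra.
From mathcomp Require Import boolp classical_sets.

(* A regular nonunit r of R lies in a prime P of R, which is also an ideal of T,
   so r t^n lies in R for all t in T and n >= 1.  Hence (r t)/r is almost
   integral over R and equals some s in R, so that r (t - s) = 0 in T.  The
   nonunits of T lie in primes of T, hence in R; thus if t were not in R then
   t - s would be a unit of T and r would be 0. *)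

Import GRing.Theory.
Local Open Scope ring_scope.
Local Open Scope classical_set_scope.

(** Zorn's lemma gives an ideal maximal among those containing [x] but not 1, and such an ideal is
    prime. *)
Lemma nonunit_sub_prime (R : comNzRingType) (x : R) :
  (forall y, x * y <> 1) -> exists2 P : set R, prime_ideal P & P x.
Proof.
move=> xNunit.
(* Guarded by non-emptiness because Zorn_bigcup also asks for the empty chain. *)
pose proper_over (I : set R) := I !=set0 -> [/\ ideal I, I x & ~ I 1].
have [F Fproper Ftot|A [Aproper Amax]] := @Zorn_bigcup R proper_over.
  move=> [z [X FX Xz]].
  have FP Y y : F Y -> Y y -> [/\ ideal Y, Y x & ~ Y 1].
    by move=> FY Yy; apply: Fproper => //; exists y.
  have [[X0 _] Xx _] := FP _ _ FX Xz.
  split; [split|by exists X|].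
  - by exists X.
  - move=> a u v [Y FY Yu] [Z FZ Zv].
    have [[_ Yid] _ _] := FP _ _ FY Yu; have [[_ Zid] _ _] := FP _ _ FZ Zv.
    case: (Ftot _ _ FY FZ) => [YZ|ZY].
      by exists Z => //; apply: Zid => //; apply: YZ.
    by exists Y => //; apply: Yid => //; apply: ZY.
  - by move=> [Y FY Y1]; have [_ _] := FP _ _ FY Y1.
have [|[A0 Aid] Ax AN1] := Aproper.
  (* The empty set satisfies [proper_over] vacuously; it is not maximal, because the principal ideal
     [xR] is proper, [x] being a nonunit. *)
  apply/set0P/negP => /eqP A0; pose xR : set R := range ( *%R x).
  have xRx : xR x by exists 1; rewrite ?mulr1.
  apply: (Amax xR); first by rewrite A0; split=> // /(_ x xRx).
  move=> _; split=> //; last by move=> [y _]; apply: xNunit.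
  split; first by exists 0; rewrite ?mulr0.
  by move=> a _ _ [u _ <-] [v _ <-]; exists (a * u + v); rewrite // mulrDr mulrCA.
exists A => //; split.
  split; first by rewrite in_setE.
    by apply/negP; rewrite in_setE.
  by move=> a u v; rewrite !in_setE; apply: Aid.
move=> u v; rewrite !in_setE => Auv.
apply/orP; rewrite !in_setE; have [|AuN] := pselect (A u); [by left|right].
(* [J] is the ideal [A + R u]. Maximality forces 1 into it, and multiplying [1 = a + c * u] by [v]
   puts [v] in [A]. *)
pose J := [set z | exists a c, A a /\ z = a + c * u].
have AJ : A `<=` J by move=> a Aa; exists a, 0; rewrite mul0r addr0.
have [[a [c [Aa eq1]]]|JN1] := pselect (J 1).
  rewrite -[v]mul1r eq1 mulrDl -mulrA [a * v]mulrC.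
  by apply: (Aid) => //; rewrite -[c * _]addr0; apply: Aid.
case: (Amax J).
  split=> // JA; apply/AuN/JA; exists 0, 1; split=> //.
  by rewrite add0r mul1r.
move=> _; split=> //; last exact: AJ.
split; first exact: AJ.
move=> d _ _ [a1 [c1 [Aa1 ->]]] [a2 [c2 [Aa2 ->]]].
exists (d * a1 + a2), (d * c1 + c2); split; first exact: Aid.
by rewrite mulrDr mulrDl addrACA mulrA.
Qed.

(** If every regular element were a unit, each fraction [a / r] would already lie in [R]. *)
Lemma proper_regular_nonunit (R : comNzRingType) :
  range (@TotalQuotient.tofrac R) <> [set: total_quotient R] ->
  exists2 r : R, GRing.lreg r & forall y, r * y <> 1.
Proof.
move=> Rneq; apply: contrapT => allunit; apply: Rneq; apply/seteqP; split=> // x _.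
have [a [r [rreg rx]]] := TotalQuotient.tofrac_surj x.
have [[y ry]|rNunit] := pselect (exists y, r * y = 1).
  exists (y * a) => //.
  by rewrite rmorphM /= -rx mulrA -rmorphM /= [y * r]mulrC ry rmorph1 mul1r.
by case: allunit; exists r => // y ry; apply: rNunit; exists y.
Qed.

(** The fraction [x = b / r], with [f b = f r * t], stands in for [t] inside the total quotient
    ring. The factor [f r] is kept because it is not known to be regular in [T]. *)
Lemma cic_divides (R T : comNzRingType) (f : {rmorphism R -> T}) (r : R) (t : T) :
  completely_integrally_closed R -> injective f -> GRing.lreg r ->
  (forall n, (0 < n)%N -> range f (f r * t ^+ n)) ->
  exists s, f r * t = f r * f s.
Proof.
move=> Rcic finj rreg rtn.
have [b _ fb] := rtn 1%N isT; rewrite expr1 in fb.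
have [u ru] := TotalQuotient.tofrac_unit rreg.
pose x := TotalQuotient.tofrac b * u.
have rx : TotalQuotient.tofrac r * x = TotalQuotient.tofrac b.
  by rewrite /x mulrCA ru mulr1.
have : complete_integral_closure x.
  exists r => // n n_gt0; have [c _ fc] := rtn n n_gt0; exists c => //.
  (* This is [r * x ^+ n = c] with denominators cleared; it is checked in [T], where both sides
     become [f r ^+ n.+1 * t ^+ n]. *)
  have rc : r ^+ n * c = r * b ^+ n.
    by apply: finj; rewrite !rmorphM !rmorphXn /= fc fb exprMn mulrCA.
  rewrite /x exprMn mulrA -rmorphXn -rmorphM /= -rc rmorphM rmorphXn /=.
  by rewrite mulrAC -exprMn ru expr1n mul1r.
rewrite -Rcic => -[s _ sx]; exists s.
rewrite -fb -rmorphM; congr (f _); apply: (@TotalQuotient.tofrac_inj R).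
by rewrite rmorphM /= sx rx.
Qed.

Theorem corollary2p17 (R : comNzRingType)
    (R_H0 : class_H0 R)
    (R_cic : completely_integrally_closed R)
    (R_neq : range (@TotalQuotient.tofrac R) <> [set: total_quotient R]) :
  ~ exists (T : comNzRingType) (f : {rmorphism R -> T}),
      [/\ injective f, range f <> [set: T] & same_spec f].
Proof.
move=> [T [f [finj fsurj [specRT specTR]]]].
have [r rreg rNunit] := @proper_regular_nonunit R R_neq.
have [P Pprime Pr] := @nonunit_sub_prime R r rNunit.
have [[fP0 _ fPid] _] := specRT P Pprime.
have rt_range (t : T) : range f (f r * t).
  have : t * f r + 0 \in f @` P by apply: fPid => //; rewrite in_setE; exists r.
  by rewrite in_setE addr0 mulrC => -[p _ <-]; exists p.
apply: fsurj; apply/seteqP; split=> // t _.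
have [s rts] :=
  @cic_divides R T f r t R_cic finj rreg (fun n _ => rt_range (t ^+ n)).
have [[y tsy]|tsNunit] := pselect (exists y, (t - f s) * y = 1).
  have fr0 : f r = 0 by rewrite -[f r]mulr1 -tsy mulrA mulrBr rts subrr mul0r.
  have r0 : r = 0 by apply: finj; rewrite fr0 rmorph0.
  (* Cancelling the regular element [r] would give [1 = 0] in [R]. *)
  have /rreg/eqP : r * 1 = r * 0 by rewrite r0 !mul0r.
  by rewrite oner_eq0.
have [Q Qprime Qts] :=
  @nonunit_sub_prime T (t - f s) (fun y e => tsNunit (ex_intro _ y e)).
(* As [Q] lies in the image of [R], so does [t - f s], and hence [t]. *)
have [/(_ _ Qts)[a _ fa] _] := specTR Q Qprime.
by exists (a + s) => //; rewrite rmorphD /= fa subrK.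
Qed.
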